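(* Let $Q$ be a finite (left) quasifield with $q$ elements. If $A \subset Q \setminus \{0\}$, $|A+A| = m$ and $|A \cdot A| = n$, then \[ |A|^2 \leq \frac{mn|A|}{q} + q^{1/2}\sqrt{mn}. \]
   Context: A (left) quasifield is a set $Q$ with two binary operations $+$ and $\cdot$ such that $(Q,+)$ is a group with identity $0$; $(Q\setminus\{0\},\cdot)$ is a loop (for all $a,b$ the equations $a\cdot x=b$ and $y\cdot a=b$ have unique solutions $x$, $y$, and there is an identity element $1$ with $1\cdot x = x\cdot 1 = x$); $a\cdot(b+c)=a\cdot b+a\cdot c$ for all $a,b,c\in Q$; $0\cdot x=0$ for all $x\in Q$; and for all $a,b,c\in Q$ with $a\neq b$ the equation $a\cdot x=b\cdot x+c$ has exactly one solution $x$. For $A\subset Q$, $A+A=\{a+b: a,b\in A\}$ and $A\cdot A=\{a\cdot b: a,b\in A\}$. *)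

(* Defs.v *)
From mathcomp Require Import all_boot all_order all_algebra.

Set Implicit Arguments.
Unset Strict Implicit.
Unset Printing Implicit Defensive.

(* The additive group of a quasifield is not assumed to be commutative, so it
   is not stated as a zmodType. *)
Definition is_group (T : Type) (e : T) (op : T -> T -> T) : Prop :=
  [/\ associative op, left_id e op, right_id e op &
      forall a, exists b, op b a = e /\ op a b = e].

(* The restriction of [op] to the subset [P] is a loop. *)
Definition is_loop_on (T : Type) (P : T -> Prop) (op : T -> T -> T) : Prop :=
  [/\ forall a b, P a -> P b -> P (op a b),
      forall a b, P a -> P b -> exists! x, P x /\ op a x = b,
      forall a b, P a -> P b -> exists! y, P y /\ op y a = b &
      exists2 e, P e & forall x, P x -> op e x = x /\ op x e = x].

Record is_left_quasifield (Q : Type) (zero : Q) (add mul : Q -> Q -> Q) : Prop :=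
  IsLeftQuasifield {
    lqf_add_group : is_group zero add;
    lqf_mul_loop : is_loop_on (fun x => x <> zero) mul;
    lqf_mulDr : forall a b c, mul a (add b c) = add (mul a b) (mul a c);
    lqf_mul0x : forall x, mul zero x = zero;
    lqf_planar : forall a b c, a <> b ->
      exists! x, mul a x = add (mul b x) c
  }.

Definition setwise_op (Q : finType) (op : Q -> Q -> Q) (A B : {set Q}) : {set Q} :=
  [set op a b | a in A, b in B].

(* Main.v *)
(** Read the elements of [Q * Q] both as points [(x, y)] and as lines [(a, t)],
    with [(x, y)] on [(a, t)] when [a x = y + t]. Every line has [q] points and,
    by planarity, two lines share at most one, so a second moment computation
    bounds the deviation of the number of incidences between a set of points [X]
    and a set of lines [B] from [#|X| #|B| / q] by [sqrt (q #|X| #|B|)]. Take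
    [X = (A + A) * (A A)] and the lines [(a, a b)] with [a, b] in [A]: by left
    distributivity [(c + b, a c)] is on [(a, a b)] for each [c] in [A], which
    gives at least [#|A| ^ 3] incidences. *)
Require Import Defs.
From mathcomp Require Import all_boot all_order all_algebra.
From mathcomp Require Import ring lra.
Import Order.TTheory GRing.Theory Num.Theory.
Local Open Scope ring_scope.

(** Cauchy-Schwarz against the constant function 1, read off from the sum of the squares of
    [c * d i - s]. *)
Lemma sqr_sum_le (R : realFieldType) (T : finType) (X : {set T}) (d : T -> R) :
  (\sum_(i in X) d i) ^+ 2 <= #|X|%:R * \sum_(i in X) d i ^+ 2.
Proof.
have [->|X0] := eqVneq X set0; first by rewrite !big_set0 cards0 expr0n mul0r.
set s := \sum_(i in X) d i; set c : R := #|X|%:R.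
have c0 : 0 < c by rewrite ltr0n card_gt0.
have : 0 <= \sum_(i in X) (c * d i - s) ^+ 2.
  by apply: sumr_ge0 => i _; exact: sqr_ge0.
have -> : \sum_(i in X) (c * d i - s) ^+ 2 =
    c * (c * (\sum_(i in X) d i ^+ 2) - s ^+ 2).
  transitivity (\sum_(i in X) (c ^+ 2 * d i ^+ 2 - 2 * c * s * d i + s ^+ 2)).
    by apply: eq_bigr => i _; ring.
  rewrite !big_split /= sumrN -!mulr_sumr sumr_const -/s -mulr_natl -/c; ring.
by rewrite pmulr_rge0 // subr_ge0.
Qed.

Lemma sum_indic (R : pzSemiRingType) (T : finType) (p : pred T) :
  \sum_i (p i)%:R = #|[set i | p i]|%:R :> R.
Proof. by rewrite -natr_sum -big_mkcond sum1dep_card. Qed.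

(** Let [N p] count the lines of [B] through [p]. Its mean over the [q ^ 2] points is [b / k], and
    its squared deviations from that mean sum to at most [b * k]. Cauchy-Schwarz on [X]
    concludes. *)
Lemma incidence_bound (R : realFieldType) (P L : finType) (I : P -> L -> bool)
    (q : nat) (q_gt0 : (0 < q)%N) (cardP : #|P| = (q ^ 2)%N)
    (card_line : forall l, #|[set p | I p l]| = q)
    (card_meet : forall l l', l != l' -> (#|[set p | I p l && I p l']| <= 1)%N)
    (X : {set P}) (B : {set L}) :
  (\sum_(p in X) \sum_(l in B) (I p l)%:R - #|X|%:R * #|B|%:R / q%:R) ^+ 2
    <= q%:R * #|X|%:R * #|B|%:R :> R.
Proof.
set N := fun p => \sum_(l in B) (I p l)%:R : R.
set b : R := #|B|%:R; set x : R := #|X|%:R; set k : R := q%:R.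
have k0 : k != 0 by rewrite pnatr_eq0 -lt0n.
have sumN : \sum_p N p = b * k.
  rewrite exchange_big /= (eq_bigr (fun=> k)); last first.
    by move=> l _; rewrite sum_indic card_line.
  by rewrite sumr_const -mulr_natl.
have sumN2 : \sum_p N p ^+ 2 <= b * k + b ^+ 2.
  have -> : \sum_p N p ^+ 2 =
      \sum_(l in B) \sum_(l' in B) #|[set p | I p l && I p l']|%:R.
    transitivity (\sum_p \sum_(l in B) \sum_(l' in B) (I p l && I p l')%:R : R).
      apply: eq_bigr => p _; rewrite expr2 mulr_suml; apply: eq_bigr => l _.
      by rewrite mulr_sumr; apply: eq_bigr => l' _; rewrite -natrM mulnb.
    rewrite exchange_big; apply: eq_bigr => l _ /=.
    by rewrite exchange_big; apply: eq_bigr => l' _; rewrite sum_indic.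
  (* For each [l], the diagonal term [l' = l] gives [k]; the other [b - 1] terms are at most 1 each,
     and their sum is bounded by [b]. *)
  have -> : b * k + b ^+ 2 = \sum_(l in B) (k + b).
    by rewrite sumr_const -mulr_natl -/b; ring.
  apply: ler_sum => l lB; rewrite (bigD1 l) //=; apply: lerD.
    under eq_finset do rewrite andbb.
    by rewrite card_line.
  rewrite /b -sum1_card natr_sum [leRHS](bigD1 l) //= -[leLHS]add0r.
  apply: lerD => //; apply: ler_sum => l' /andP[_ nl].
  by rewrite ler_nat card_meet // eq_sym.
have -> : \sum_(p in X) N p - x * b / k = \sum_(p in X) (N p - b / k).
  by rewrite big_split /= sumr_const -mulr_natl -/x mulrN mulrA.
apply: le_trans (sqr_sum_le _ _ _ _) _.
rewrite [k * x]mulrC -mulrA ler_wpM2l ?ler0n //.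
apply: (@le_trans _ _ (\sum_p (N p - b / k) ^+ 2)).
  rewrite [leRHS](bigID (mem X)) /= lerDl.
  by apply: sumr_ge0 => p _; exact: sqr_ge0.
(* The cross term contributes [- 2 * b ^+ 2], the constant term [b ^+ 2]. *)
have -> : \sum_p (N p - b / k) ^+ 2 = \sum_p N p ^+ 2 - b ^+ 2.
  transitivity (\sum_p (N p ^+ 2 - 2 * (b / k) * N p + (b / k) ^+ 2)).
    by apply: eq_bigr => p _; ring.
  rewrite !big_split /= sumrN -mulr_sumr sumN sumr_const cardP.
  by rewrite -[_ ^+ 2 *+ _]mulr_natl natrX -/k; field.
lra.
Qed.

Lemma group_op_inj (T : Type) (e : T) (op : T -> T -> T) :
  is_group e op -> right_injective op /\ left_injective op.
Proof.
case=> opA op1 opr1 opV; split=> z u v.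
  have [w [wz _]] := opV z => /(congr1 (op w)).
  by rewrite !opA wz !op1.
have [w [_ zw]] := opV z => /(congr1 (op^~ w)).
by rewrite -!opA zw !opr1.
Qed.

Section Plane.

Variables (Q : finType) (zero : Q) (add mul : Q -> Q -> Q).
Hypothesis hQ : is_left_quasifield zero add mul.

Definition on_line (p l : Q * Q) : bool := mul l.1 p.1 == add p.2 l.2.

(** The line [(a, t)] is the graph of [x |-> a x - t]. *)
Lemma card_on_line (l : Q * Q) : #|[set p | on_line p l]| = #|Q|.
Proof.
have [addA _ addr0 addV] := lqf_add_group hQ.
case: l => a t; have [u [ut tu]] := addV t.
have -> : [set p | on_line p (a, t)] = [set (x, add (mul a x) u) | x in Q].
  apply/setP=> -[x y]; rewrite inE /on_line /=; apply/eqP/imsetP.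
    by move=> axE; exists x; rewrite // axE -addA tu addr0.
  by case=> z _ [-> ->]; rewrite -addA ut addr0.
by rewrite card_imset // => x y [].
Qed.

(** Distinct lines with [a = a'] are disjoint by cancellation. Otherwise eliminating [y] gives
    [a x = a' x + (- t' + t)], in this order since addition may not commute, and planarity
    determines [x], hence [y]. *)
Lemma on_line_meet (l l' : Q * Q) : l != l' ->
  (#|[set p | on_line p l && on_line p l']| <= 1)%N.
Proof.
have [addA add0 _ addV] := lqf_add_group hQ.
have [addI addIr] := group_op_inj _ _ _ (lqf_add_group hQ).
case: l l' => a t [a' t'] ll'; apply/card_le1_eqP => -[x y] [x' y'].
rewrite !inE /on_line /= => /andP[/eqP e1 /eqP e2] /andP[/eqP e3 /eqP e4].
have [aa'|/eqP aa'] := eqVneq a a'.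
  by case/negP: ll'; rewrite -aa' e1 in e2 *; rewrite (addI _ _ _ e2).
have [u [_ tu]] := addV t'.
have abs z w : mul a z = add w t -> mul a' z = add w t' ->
    mul a z = add (mul a' z) (add u t).
  by move=> -> ->; rewrite -addA (addA t') tu add0.
have [z [_ zP]] := lqf_planar hQ (add u t) aa'.
have xx' : x = x' by rewrite -(zP x (abs _ _ e1 e2)) -(zP x' (abs _ _ e3 e4)).
by rewrite xx' e3 in e1 *; rewrite (addIr _ _ _ e1).
Qed.

(** Planarity for [a] and [zero]: the equation [a x = 0 x + a c] has a single solution. This covers
    the argument [zero], on which the loop is silent. *)
Lemma quasifield_mulI (a : Q) : a <> zero -> injective (mul a).
Proof.
move=> a0 b c; have [_ addIr] := group_op_inj _ _ _ (lqf_add_group hQ).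
have [_ add0 _ _] := lqf_add_group hQ.
have [z [_ zP]] := lqf_planar hQ (mul a c) a0.
move=> bc; rewrite -(zP b) ?(lqf_mul0x hQ) ?add0 //.
by apply: zP; rewrite (lqf_mul0x hQ) add0.
Qed.

End Plane.

Theorem theorem1p4 (R : rcfType) (Q : finType) (zero : Q) (add mul : Q -> Q -> Q)
    (hQ : is_left_quasifield zero add mul) (q : nat) (hq : #|Q| = q)
    (A : {set Q}) (hA : A \subset [set~ zero]) (m n : nat)
    (hm : #|setwise_op add A A| = m) (hn : #|setwise_op mul A A| = n) :
  (#|A|%:R : R) ^+ 2 <=
    m%:R * n%:R * #|A|%:R / q%:R + Num.sqrt q%:R * Num.sqrt (m%:R * n%:R).
Proof.
have q_gt0 : (0 < q)%N by rewrite -hq; apply/card_gt0P; exists zero.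
have A_neq0 a : a \in A -> a <> zero.
  by move/(subsetP hA); rewrite !inE => /eqP.
have mulI a : a \in A -> injective (mul a).
  by move=> aA; exact: quasifield_mulI hQ _ (A_neq0 a aA).
pose X := setX (setwise_op add A A) (setwise_op mul A A).
pose f (ab : Q * Q) := (ab.1, mul ab.1 ab.2).
pose B := f @: setX A A.
(* As [A] avoids [zero], distinct pairs give distinct lines. *)
have f_inj : {in setX A A &, injective f}.
  by move=> [a b] [a' b'] /setXP[aA _] _ [<-] /(mulI _ aA) ->.
have cardB : #|B| = (#|A| ^ 2)%N by rewrite card_in_imset // cardsX.
have cardX : #|X| = (m * n)%N by rewrite cardsX hm hn.
have [_ addIr] := group_op_inj _ _ _ (lqf_add_group hQ).
have inc : #|A|%:R ^+ 3 <=
    \sum_(p in X) \sum_(l in B) (on_line _ add mul p l)%:R :> R.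
  rewrite exchange_big /= big_imset //=.
  (* The cube becomes a sum of [#|A|] over pairs [(a, b)], to be compared line by line. *)
  rewrite exprSr -natrX -cardB card_in_imset // -sum1_card natr_sum mulr_suml.
  apply: ler_sum => -[a b] /setXP[aA bA]; rewrite mul1r.
  rewrite -natr_sum -big_mkcondr sum1dep_card ler_nat.
  rewrite -(@card_imset _ _ (fun c => (add c b, mul a c))); last first.
    by move=> c c' [/addIr].
  apply/subset_leq_card/subsetP => _ /imsetP[c cA ->].
  by rewrite !inE /on_line /= (lqf_mulDr hQ) eqxx !imset2_f.
have cardP : #|{: Q * Q}| = (q ^ 2)%N by rewrite card_prod hq.
have cardl l : #|[set p | on_line _ add mul p l]| = q by rewrite (card_on_line _ _ _ _ hQ).
have := @incidence_bound R _ _ _ q q_gt0 cardP cardl (on_line_meet _ _ _ _ hQ) X B.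
rewrite cardB cardX natrX natrM.
set S := \sum_(p in X) _ in inc *; set k : R := #|A|%:R in inc *.
set M : R := m%:R * n%:R => bound.
(* The incidence bound yields the claim multiplied by [k], so empty [A] is treated apart. *)
have [k0|k_neq0] := eqVneq k 0.
  rewrite k0 expr0n mulr0 mul0r add0r; exact: mulr_ge0 (sqrtr_ge0 _) (sqrtr_ge0 _).
have k_gt0 : 0 < k by rewrite lt_def k_neq0 ler0n.
rewrite -(ler_pM2l k_gt0).
set D := S - M * k ^+ 2 / q%:R in bound.
have D_le : D <= k * Num.sqrt q%:R * Num.sqrt M.
  apply: le_trans (ler_norm _) _; rewrite -sqrtr_sqr.
  apply: le_trans (ler_wsqrtr bound) _.
  rewrite [_ * k ^+ 2]mulrC sqrtrM ?sqr_ge0 // sqrtr_sqr ger0_norm ?ler0n //.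
  by rewrite sqrtrM ?ler0n // mulrA.
have := le_trans (lerB inc (lexx (M * k ^+ 2 / q%:R))) D_le.
rewrite lerBlDl; congr (_ <= _); ring.
Qed.
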